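(* A continuous image of a $\theta$-Hurewicz space is $\theta$-Hurewicz; that is, if $X$ is a $\theta$-Hurewicz topological space and $f:X\to Y$ is a continuous map from $X$ onto a topological space $Y$, then $Y$ is $\theta$-Hurewicz.
   Context: A subset $A$ of a topological space is $\theta$-open if for every $x\in A$ there is an open set $B$ with $x\in B\subseteq \mathrm{Cl}(B)\subseteq A$. A space $X$ is $\theta$-Hurewicz if for each sequence $(\mathcal{A}_k:k\in\mathbb{N})$ of covers of $X$ by $\theta$-open sets there exists a sequence $(\mathcal{B}_k:k\in\mathbb{N})$ such that each $\mathcal{B}_k$ is a finite subset of $\mathcal{A}_k$ and for each $x\in X$, $x\in\bigcup\mathcal{B}_k$ for all but finitely many $k$. *)

(* Defs.v *)
From mathcomp Require Import all_boot.
From mathcomp Require Import classical_sets functions cardinality topology.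

Set Implicit Arguments.
Unset Strict Implicit.
Unset Printing Implicit Defensive.

Local Open Scope classical_set_scope.

Definition theta_open (T : topologicalType) (A : set T) : Prop :=
  forall x, A x ->
    exists B : set T, [/\ open B, B x, B `<=` closure B & closure B `<=` A].

Definition theta_open_cover (T : topologicalType) (F : set (set T)) : Prop :=
  (forall A, F A -> theta_open A) /\ \bigcup_(A in F) A = [set: T].

Definition theta_Hurewicz (T : topologicalType) : Prop :=
  forall F : nat -> set (set T),
    (forall k, theta_open_cover (F k)) ->
    exists G : nat -> set (set T),
      (forall k, finite_set (G k) /\ G k `<=` F k) /\
      (forall x : T, finite_set [set k | ~ (\bigcup_(B in G k) B) x]).

(* Main.v *)
Require Import Defs.
From mathcomp Require Import all_boot.
From mathcomp Require Import classical_sets functions cardinality topology.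

Local Open Scope classical_set_scope.

(** Pull each cover of [Y] back along [f], select finitely many members in
    [X], and push the selection forward again.  Pulling back is legitimate
    because preimages of theta-open sets under a continuous map are
    theta-open ([theta_open_preimage]).  Pushing forward lands in the original
    covers because [f] is onto, so that [f @` (f @^-1` A)] is [A] itself
    ([image_preimage]): direct images recover the members of the cover
    without any choice of preimage representatives. *)

(** Continuity gives [closure (f @^-1` B) `<=` f @^-1` closure B], the latter
    set being closed; hence a neighbourhood of [f x] witnessing theta-openness
    pulls back to one of [x]. *)
Lemma theta_open_preimage (X Y : topologicalType) (f : X -> Y) (A : set Y) :
  continuous f -> theta_open A -> theta_open (f @^-1` A).
Proof.
move=> fcont Aopen x /Aopen[B [Bopen Bfx _ BA]].
exists (f @^-1` B); split => //.
- by apply: open_comp => // z _; exact: fcont.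
- exact: subset_closure.
have cl : closed (f @^-1` closure B).
  by apply: preimage_closed; [move=> z _; exact: fcont|exact: closed_closure].
apply: (@subset_trans _ (f @^-1` closure B)); last by move=> z; exact: BA.
rewrite [X in _ `<=` X](closure_id _).1 //.
by apply: closureS => z; exact: (@subset_closure _ B).
Qed.

Lemma theta_open_cover_preimage (X Y : topologicalType) (f : X -> Y)
    (F : set (set Y)) :
  continuous f -> theta_open_cover F ->
  theta_open_cover [set f @^-1` A | A in F].
Proof.
move=> fcont [Fopen Fcover]; split.
  by move=> _ [A FA <-]; apply: theta_open_preimage => //; exact: Fopen.
rewrite -subTset => x _.
have [A FA Afx] : (\bigcup_(A in F) A) (f x) by rewrite Fcover.
by exists (f @^-1` A) => //; exists A.
Qed.

Theorem corollary3p10 (X Y : topologicalType) (f : X -> Y)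
    (hX : theta_Hurewicz X) (fcont : continuous f)
    (fsurj : set_surj [set: X] [set: Y] f) :
  theta_Hurewicz Y.
Proof.
move=> F Fcover.
have [G [GF Gx]] := hX _ (fun k => theta_open_cover_preimage _ _ _ _ fcont (Fcover k)).
have frange : range f = setT by apply/seteqP; split.
exists (fun k => [set f @` B | B in G k]); split.
  move=> k; have [Gfin Gsub] := GF k; split; first exact: finite_image.
  move=> _ [B /Gsub[A FA <-] <-].
  by rewrite image_preimage.
move=> y; have [x _ <-] := fsurj y I.
(* Indices missing [f x] already miss [x]. *)
apply: sub_finite_set (Gx x) => k /= nfx [B GB Bx]; apply: nfx.
by exists (f @` B); [exists B|exists x].
Qed.
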